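(* Let $(\Omega,\mathcal{F},\mathbf{P})$ be a probability space and let $\{C_n : n\geq 1\}$ be a $C$-process defined on it, i.e. the $C_n$ take values in $\mathbb{N}=\{1,2,3,\dots\}$ and the sequence $C_0,C_1,C_2,\ldots$ with $C_0=1$ is a time-homogeneous Markov chain with one-step transition probabilities $p_{ij}=\frac{i}{j(j-1)}$ for $j\geq i+1$ and $p_{ij}=0$ for $j\leq i$. Then the sequence $\left\{\frac{\log C_n-n}{n}: n\geq 1\right\}$ satisfies a large deviation principle with speed $n$ and good rate function $$I_C(x)=\begin{cases} x-\log(x+1), & \text{if } x>-1,\\ +\infty, & \text{if } x\leq -1.\end{cases}$$
   Context: A function $I:\mathbb{R}\to[0,\infty]$ is a good rate function if it is lower semicontinuous and has compact level sets (i.e. $\{x\in\mathbb{R}: I(x)\le\alpha\}$ is compact for every $\alpha\in[0,\infty)$). A sequence $\{Y_n:n\geq1\}$ of real-valued random variables on $(\Omega,\mathcal{F},\mathbf{P})$ satisfies a large deviation principle with speed $n$ and good rate function $I$ if $I$ is a good rate function and, for every Borel set $\Gamma\subseteq\mathbb{R}$, $$-\inf_{x\in\Gamma^\circ}I(x)\leq\liminf_{n\to\infty}\frac1n\log\mathbf{P}(Y_n\in\Gamma)\leq\limsup_{n\to\infty}\frac1n\log\mathbf{P}(Y_n\in\Gamma)\leq-\inf_{x\in\overline{\Gamma}}I(x),$$ where $\Gamma^\circ$ and $\overline{\Gamma}$ denote the interior and the closure of $\Gamma$; the conventions are $\log 0=-\infty$ and $\inf\emptyset=+\infty$. Here $\log$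 is the natural logarithm. *)

(* Defs.v *)
From HB Require Import structures.
From mathcomp Require Import all_boot all_order all_algebra.
From mathcomp Require Import all_classical all_reals all_analysis.
Set Implicit Arguments.
Unset Strict Implicit.
Unset Printing Implicit Defensive.
Import Order.TTheory GRing.Theory Num.Theory.
Import numFieldNormedType.Exports.

Local Open Scope classical_set_scope.
Local Open Scope ring_scope.

(* Meaningful only when P B != 0. *)
Definition cond_prob d (T : measurableType d) (R : realType)
    (P : probability T R) (A B : set T) : R :=
  fine (P (A `&` B)) / fine (P B).

Definition history d (T : measurableType d) (R : realType)
    (P : probability T R) (X : nat -> {RV P >-> nat}) (n : nat)
    (h : nat -> nat) : set T :=
  [set w | forall k, (k <= n)%N -> X k w = h k].

(* The transition probability from h n does not depend on the earlier states
   (Markov property) nor on n (time homogeneity). Only histories of positive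
   probability are constrained, so the values p i j at unreachable states i are
   irrelevant. *)
Definition markov_chain d (T : measurableType d) (R : realType)
    (P : probability T R) (p : nat -> nat -> R) (X : nat -> {RV P >-> nat}) :=
  forall (n : nat) (h : nat -> nat) (j : nat),
    (0 < P (history X n h))%E ->
    cond_prob P (X n.+1 @^-1` [set j]) (history X n h) = p (h n) j.

Definition C_transition (R : realType) (i j : nat) : R :=
  if (i < j)%N then i%:R / (j%:R * (j%:R - 1)) else 0.

(* C 0 is the constant initial state; the process proper is C n for n >= 1. *)
Definition C_process d (T : measurableType d) (R : realType)
    (P : probability T R) (C : nat -> {RV P >-> nat}) :=
  [/\ forall n w, (0 < C n w)%N,
      forall w, C 0%N w = 1%N
    & markov_chain (@C_transition R) C].

Section log_C_normalized.
Context d (T : measurableType d) (R : realType) (P : probability T R).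
Variables (C : nat -> {RV P >-> nat}) (n : nat).

Definition log_C_normalized (w : T) : R := (ln (C n w)%:R - n%:R) / n%:R.

Let measurable_log_C_normalized : measurable_fun setT log_C_normalized.
Proof.
pose f k : R := (ln k%:R - n%:R) / n%:R.
have mf : measurable_fun setT f by [].
exact: (measurableT_comp mf (@measurable_funPT _ _ _ _ (C n))).
Qed.

HB.instance Definition _ :=
  isMeasurableFun.Build _ _ _ _ log_C_normalized measurable_log_C_normalized.

End log_C_normalized.

Definition good_rate_function (R : realType) (I : R -> \bar R) :=
  [/\ forall x, (0 <= I x)%E,
      lower_semicontinuous I
    & forall a : R, 0 <= a -> compact [set x | (I x <= a%:E)%E]].

(* The term n = 0, where 0^-1 = 0, does not affect the limits. [lne] sends 0 to
   -oo and [ereal_inf] sends set0 to +oo. *)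
Definition scaled_log_prob d (T : measurableType d) (R : realType)
    (P : probability T R) (Y : nat -> {RV P >-> R}) (G : set R) (n : nat)
    : \bar R :=
  ((n%:R^-1)%:E * lne (P (Y n @^-1` G)))%E.

Definition large_deviation_principle d (T : measurableType d) (R : realType)
    (P : probability T R) (Y : nat -> {RV P >-> R}) (I : R -> \bar R) :=
  good_rate_function I /\
  forall G : set R, measurable G ->
    [/\ (- ereal_inf (I @` G°) <= limn_einf (scaled_log_prob Y G))%E,
        (limn_einf (scaled_log_prob Y G) <= limn_esup (scaled_log_prob Y G))%E
      & (limn_esup (scaled_log_prob Y G) <= - ereal_inf (I @` closure G))%E].

Definition I_C (R : realType) (x : R) : \bar R :=
  if -1 < x then (x - ln (x + 1))%:E else +oo%E.

(* Main.v *)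
Require Import Defs.
From mathcomp Require Import all_boot all_order all_algebra.
From mathcomp Require Import all_classical all_reals all_analysis.
From mathcomp Require Import measurable_realfun.
From mathcomp Require Import ring lra.
Set Implicit Arguments.
Unset Strict Implicit.
Unset Printing Implicit Defensive.
Import Order.TTheory GRing.Theory Num.Theory.
Import numFieldNormedType.Exports.
Local Open Scope classical_set_scope.
Local Open Scope ring_scope.

(** For every z > 0 the function h_z(i) = i * prod_(1 <= l < i) l / (l + z) is an
    exact eigenfunction of the transition kernel with eigenvalue 1 / z, so that
    E h_z(C_n) = z^-n.  Since h_z(i) is i^(1 - z) up to constants, E C_n^(1 - z)
    is z^-n up to constants.  The upper bound is then Chernoff's with
    z = 1 / (1 + x).  For the lower bound at x, the moment E C_n^(1 - z) is
    carried by the event |log C_n / n - (1 + x)| <= e: outside of it, the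
    moments for z (1 - u) and z (1 + u) with u small give contributions that
    are exponentially smaller than z^-n. *)

(** * Eigenfunctions of the transition kernel and their growth *)

Section Eigenfunction.
Context {R : realType}.
Implicit Types (z u x : R).

(** This is [ln (1 + v) <= v] at [v = - u / (1 + u)], for which [1 + v] is the inverse of
    [1 + u]. *)
Lemma ln1D_ge u : -1 < u -> u / (1 + u) <= ln (1 + u).
Proof.
move=> u1; have p : 0 < 1 + u by lra.
have e : 1 - u / (1 + u) = (1 + u)^-1 by field; rewrite gt_eqF.
have ip : 0 < (1 + u)^-1 by rewrite invr_gt0.
have := @le_ln1Dx R (- (u / (1 + u))).
rewrite e lnV ?posrE// => H.
have : - ln (1 + u) <= - (u / (1 + u)) by apply: H; lra.
lra.
Qed.

(** The generalized binomial coefficient Gamma(n + 1 + z) / (Gamma(1 + z) n!), of order n^z. *)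
Definition growth z n : R := \prod_(l < n) (1 + z / l.+1%:R).

Lemma growth_gt0 z n : 0 < z -> 0 < growth z n.
Proof.
by move=> z0; apply: prodr_gt0 => l _; rewrite addr_gt0// divr_gt0// ltr0n.
Qed.

Lemma growthS z n : growth z n.+1 = growth z n * (1 + z / n.+1%:R).
Proof. by rewrite /growth big_ord_recr. Qed.

Lemma ln_growthS z n : 0 < z ->
  ln (growth z n.+1) = ln (growth z n) + ln (1 + z / n.+1%:R).
Proof.
move=> z0; rewrite growthS lnM// ?posrE ?growth_gt0//.
by rewrite addr_gt0// divr_gt0// ltr0n.
Qed.

(** The first factor gives [ln (1 + z)]. For l >= 2, ln (1 + z / l) <= z / l <= z (ln l - ln (l -
    1)), which telescopes. *)
Lemma ln_growth_le z n : 0 < z ->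
  ln (growth z n) <= ln (1 + z) + z * ln n.+1%:R.
Proof.
move=> z0.
suff H m : ln (growth z m.+1) <= ln (1 + z) + z * ln m.+1%:R.
  case: n => [|n].
    by rewrite /growth big_ord0 !ln1 mulr0 addr0 ln_ge0//; lra.
  apply: (le_trans (H n)); rewrite lerD2l ler_pM2l// ler_ln ?posrE ?ltr0n//.
  by rewrite ler_nat.
elim: m => [|m IH].
  by rewrite ln_growthS// /growth big_ord0 ln1 mulr0 divr1; lra.
rewrite ln_growthS//.
have a0 : 0 < m.+1%:R :> R by rewrite ltr0n.
have b0 : 0 < m.+2%:R :> R by rewrite ltr0n.
have step1 : ln (1 + z / m.+2%:R) <= z / m.+2%:R.
  by apply: le_ln1Dx; rewrite (lt_trans _ (divr_gt0 z0 b0))//; lra.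
have step2 : m.+2%:R^-1 <= ln m.+2%:R - ln m.+1%:R :> R.
  have u1 : -1 < m.+1%:R^-1 :> R by rewrite (@lt_trans _ _ 0)// ?invr_gt0//; lra.
  have := ln1D_ge u1.
  have -> : 1 + m.+1%:R^-1 = m.+2%:R / m.+1%:R :> R.
    by rewrite -[in RHS]addn1 natrD; field; rewrite addrC natr1 pnatr_eq0.
  rewrite ln_div ?posrE//; congr (_ <= _).
  by field; rewrite -!natr1; apply/andP; split; rewrite ?pnatr_eq0// gt_eqF//; nra.
have : z / m.+2%:R <= z * (ln m.+2%:R - ln m.+1%:R) by rewrite ler_pM2l.
move: step1 IH; rewrite mulrBr; move: (z / _) (ln (1 + _ / _)) => q r; lra.
Qed.

Lemma ln_growth_ge z n : 0 < z ->
  z * ln n.+1%:R - z * ln (1 + z) <= ln (growth z n).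
Proof.
move=> z0.
(* The shift by [z] makes the induction telescope: ln (1 + z / l) >= z / (l + z) >= z (ln (l + 1 +
   z) - ln (l + z)). *)
suff H : z * ln (n.+1%:R + z) - z * ln (1 + z) <= ln (growth z n).
  apply: le_trans H; rewrite lerD2r ler_pM2l// ler_ln ?posrE ?ltr0n//; first lra.
  by rewrite addr_gt0// ltr0n.
elim: n => [|n IH].
  by rewrite subrr /growth big_ord0 ln1.
rewrite ln_growthS//.
have a0 : 0 < n.+1%:R :> R by rewrite ltr0n.
have b : n.+2%:R = n.+1%:R + 1 :> R by rewrite natr1.
have v0 : 0 < (n.+1%:R + z)^-1 by rewrite invr_gt0; lra.
have step1 : ln (n.+2%:R + z) - ln (n.+1%:R + z) <= (n.+1%:R + z)^-1.
  rewrite b -ln_div ?posrE; [|move: (n.+1%:R : R) a0 => w w0; lra..].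
  have -> : (n.+1%:R + 1 + z) / (n.+1%:R + z) = 1 + (n.+1%:R + z)^-1.
    by field; rewrite gt_eqF//; lra.
  by apply: le_ln1Dx; lra.
have u0 : 0 < z / n.+1%:R by rewrite divr_gt0.
have u1 : -1 < z / n.+1%:R by rewrite (lt_trans _ u0)// ltrN10.
have := ln1D_ge u1.
have -> : z / n.+1%:R / (1 + z / n.+1%:R) = z * (n.+1%:R + z)^-1.
  by field; apply/andP; split; rewrite gt_eqF//; lra.
have : z * (ln (n.+2%:R + z) - ln (n.+1%:R + z)) <= z * (n.+1%:R + z)^-1.
  by rewrite ler_pM2l.
lra.
Qed.

Definition eigenfun z i : R := i%:R / growth z i.-1.

Lemma eigenfun_ge0 z i : 0 < z -> 0 <= eigenfun z i.
Proof. by move=> z0; rewrite divr_ge0// ltW// growth_gt0. Qed.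

(** Sum of the errors [ln (1 + z)] and [z * ln (1 + z)] of the two bounds on [ln (growth z n)], so
    that one constant serves both sides. *)
Definition log_slack z : R := (1 + z) * ln (1 + z).

Lemma eigenfun_bounds z i : 0 < z -> (0 < i)%N ->
  expR ((1 - z) * ln i%:R - log_slack z) <= eigenfun z i
    <= expR ((1 - z) * ln i%:R + log_slack z).
Proof.
case: i => // i z0 _.
have e : eigenfun z i.+1 = expR (ln i.+1%:R - ln (growth z i)).
  by rewrite expRB !lnK ?posrE ?growth_gt0// ltr0n.
have H1 := ln_growth_le i z0.
have H2 := ln_growth_ge i z0.
have l0 : 0 <= ln (1 + z) by apply: ln_ge0; lra.
have zl0 : 0 <= z * ln (1 + z) by rewrite mulr_ge0// ltW.
by rewrite e !ler_expR /log_slack; apply/andP; split; lra.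
Qed.

(** The factor j of [eigenfun z j] cancels against the kernel; what remains is a difference of
    consecutive inverses of [growth], up to the factor [i.+1%:R / z]. *)
Lemma sum_C_transition_eigenfun z i n : 0 < z -> (i <= n)%N ->
  \sum_(0 <= j < n.+2) C_transition R i.+1 j * eigenfun z j
    = i.+1%:R / z * ((growth z i)^-1 - (growth z n)^-1).
Proof.
move=> z0; elim: n => [|n IH].
  rewrite leqn0 => /eqP ->.
  by rewrite subrr mulr0 !big_nat_recr//= big_geq// /C_transition/= !mul0r !addr0.
rewrite leq_eqVlt => /orP[/eqP ->|].
  rewrite subrr mulr0 big_nat_cond big1// => j /andP[/andP[_ jn] _].
  by rewrite /C_transition ltnNge -ltnS jn/= mul0r.
rewrite ltnS => leq_in; rewrite big_nat_recr//= IH//.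
rewrite /C_transition !ltnS leq_in /eigenfun/= growthS.
have p : n.+2%:R = n.+1%:R + 1 :> R by rewrite natr1.
have n0 : 0 < n.+1%:R :> R by rewrite ltr0n.
rewrite p; have := growth_gt0 n z0; have := growth_gt0 i z0.
move: (growth z i) (growth z n) (n.+1%:R : R) (i.+1%:R : R) n0 => a b c k c0 a0 b0.
by field; do ! (apply/andP; split); rewrite gt_eqF//; lra.
Qed.

Lemma growth_cvg_pinfty z : 0 < z -> growth z n @[n --> \oo] --> +oo.
Proof.
move=> z0; apply/cvgryPge => A.
(* The threshold solves z ln n - z ln (1 + z) = |A|, so that [ln_growth_ge] gives ln (growth) >=
   |A|; then growth >= ln (growth). *)
have [N _ HN] : \forall n \near \oo, expR ((`|A| + z * ln (1 + z)) / z) <= n%:R :> R.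
  by have /cvgryPge := @cvgr_idn R; exact.
exists N => // n /= Nn; apply: le_trans (ler_norm A) _.
have /HN /= : (N <= n.+1)%N by exact: leqW.
rewrite -ler_ln ?posrE ?expR_gt0 ?ltr0n// expRK ler_pdivrMr// => H.
have := ln_growth_ge n z0 => H2.
have : `|A| <= ln (growth z n) by lra.
move=> /le_trans; apply; rewrite -[leRHS](lnK (growth_gt0 n z0 : _ \is Num.pos)).
by have := expR_ge1Dx (ln (growth z n)); lra.
Qed.

(* The telescoping g(i - 1) - g(i) = z g(i) / (i - 1), for g(i) = h_z(i) / i,
   makes [eigenfun z] an exact eigenfunction of the transition kernel. *)
Lemma C_transition_eigenfun z i : 0 < z -> (0 < i)%N ->
  (\sum_(0 <= j <oo) (C_transition R i j * eigenfun z j)%:E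
    = (eigenfun z i / z)%:E)%E.
Proof.
case: i => // i z0 _; apply/cvg_lim => //.
(* The closed form of the partial sums has upper limit [n.+2] and needs [i <= n], whence the shifts
   by 2 and by [i]. *)
rewrite -(cvg_shiftn 2).
suff H : i.+1%:R / z * ((growth z i)^-1 - (growth z n)^-1) @[n --> \oo] -->
         eigenfun z i.+1 / z.
  rewrite /= -(cvg_shiftn i); apply: cvg_EFin.
    by apply: nearW => n /=; rewrite sumEFin.
  move: H; rewrite -(cvg_shiftn i); apply: cvg_trans; apply: near_eq_cvg.
  by apply: nearW => n /=; rewrite sumEFin/= addnC !addn2 sum_C_transition_eigenfun ?leq_addr.
have -> : eigenfun z i.+1 / z = i.+1%:R / z * ((growth z i)^-1 - 0).
  by rewrite subr0 /eigenfun/= mulrAC.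
apply: cvgMr; apply: cvgB; first exact: cvg_cst.
apply/gtr0_cvgV0; last exact: growth_cvg_pinfty.
by apply: nearW => n; exact: growth_gt0.
Qed.

End Eigenfunction.

(** * One-dimensional marginals of the chain and exact moments *)

Section MarkovMarginals.
Context d (T : measurableType d) (R : realType) (P : probability T R).
Implicit Types (X : nat -> {RV P >-> nat}) (Y : {RV P >-> nat}).

Lemma measurable_fiber Y i : measurable (Y @^-1` [set i]).
Proof. exact: measurable_funPTI. Qed.
Hint Resolve measurable_fiber : core.

Lemma bigcup_fiber Y : \bigcup_i (Y @^-1` [set i]) = setT.
Proof. by apply/seteqP; split => // w _; exists (Y w). Qed.

Lemma trivIset_fiber Y : trivIset setT (fun i => Y @^-1` [set i]).
Proof. by move=> i j _ _ [w [/= <- <-]]. Qed.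

Lemma probability_fibers Y (A : set T) : measurable A ->
  (P A = \sum_(0 <= i <oo) P (A `&` Y @^-1` [set i]))%E.
Proof.
move=> mA; rewrite -measure_semi_bigcup.
- by rewrite -setI_bigcupr bigcup_fiber setIT.
- by move=> i; exact: measurableI.
- by apply: trivIset_setIl; exact: trivIset_fiber.
- by rewrite -setI_bigcupr bigcup_fiber setIT.
Qed.

Lemma integral_fibers Y (f : nat -> R) : (forall i, 0 <= f i) ->
  (\int[P]_w (f (Y w))%:E = \sum_(0 <= i <oo) (f i)%:E * P (Y @^-1` [set i]))%E.
Proof.
move=> f0; rewrite -[in LHS](bigcup_fiber Y) ge0_integral_bigcup//.
- apply: eq_eseriesr => i _.
  rewrite (eq_integral (fun _ => (f i)%:E)); last first.
    by move=> w /set_mem /= ->.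
  by rewrite integral_cst.
- rewrite bigcup_fiber; apply/measurable_EFinP => /=.
  by apply: (measurableT_comp (g := Y)) => //; exact: measurable_funPT.
- by move=> w _; rewrite lee_fin.
- exact: trivIset_fiber.
Qed.

(** Interpolates between [history X n h] at [m = 0] and the single constraint on [X n] at
    [m = n]. *)
Definition recent_history X (m n : nat) (h : nat -> nat) : set T :=
  [set w | forall k, (m <= k <= n)%N -> X k w = h k].

Lemma measurable_recent_history X m n h : measurable (recent_history X m n h).
Proof.
rewrite (_ : recent_history _ _ _ _ =
  \bigcap_(k in [set k | (m <= k <= n)%N]) (X k @^-1` [set h k])); last first.
  by apply/seteqP; split => w H k; exact: H.
exact: bigcap_measurableType.
Qed.
Hint Resolve measurable_recent_history : core.

(** Induction on [m] forgets the oldest coordinate by summing over its values. The product form also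
    covers histories of probability zero, where both sides vanish. *)
Lemma markov_chain_recent p X m n h j : markov_chain p X -> (m <= n)%N ->
  P (X n.+1 @^-1` [set j] `&` recent_history X m n h)
  = ((p (h n) j)%:E * P (recent_history X m n h))%E.
Proof.
move=> mX; elim: m h => [|m IH] h mn.
  have -> : recent_history X 0 n h = history X n h by [].
  have mH : measurable (history X n h) by exact: (measurable_recent_history X 0 n h).
  have mI : measurable (X n.+1 @^-1` [set j] `&` history X n h) by exact: measurableI.
  have [P0|] := eqVneq (P (history X n h)) 0%E.
    rewrite P0 mule0; apply/eqP; rewrite -measure_le0 -P0.
    by apply: le_measure; rewrite ?inE//; exact: subIsetr.
  move=> Pn0; have P0 : (0 < P (history X n h))%E by rewrite lt0e Pn0 measure_ge0.
  have := mX n h j P0.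
  rewrite /cond_prob => <-.
  rewrite EFinM fineK ?fin_num_measure// -muleA.
  rewrite -[X in (_ * X)%E](_ : 1%E = _)%E ?mule1//.
  rewrite -[X in (_ * X)%E]fineK ?fin_num_measure// -EFinM mulVf//.
  by rewrite fine_eq0 ?fin_num_measure// gt_eqF.
(* Fixing [X m] only alters [h] at [m]; as [m < n], the state [h n] that governs the transition is
   unchanged. *)
have H i : recent_history X m.+1 n h `&` X m @^-1` [set i] =
    recent_history X m n (fun k => if k == m then i else h k).
  apply/seteqP; split => [w [Hw /= Xm] k /andP[mk kn]|w Hw].
    case: eqP => [->//|/eqP km]; apply: Hw.
    by rewrite ltn_neqAle eq_sym km mk.
  split=> [k /andP[mk kn]|]/=.
    by rewrite Hw ?(ltnW mk)// gtn_eqF.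
  by rewrite Hw ?eqxx// leqnn ltnW.
rewrite (probability_fibers (X m)); last exact: measurableI.
rewrite (probability_fibers (X m) (A := recent_history X m.+1 n h))//.
rewrite -nneseriesZl//; apply: eq_eseriesr => i _.
by rewrite -setIA H IH ?(ltnW mn)// gtn_eqF.
Qed.

Lemma markov_chain_step p X n j : markov_chain p X ->
  (P (X n.+1 @^-1` [set j])
   = \sum_(0 <= i <oo) (p i j)%:E * P (X n @^-1` [set i]))%E.
Proof.
move=> mX; rewrite (probability_fibers (X n))//; apply: eq_eseriesr => i _.
have <- : recent_history X n n (fun=> i) = X n @^-1` [set i].
  apply/seteqP; split => w Hw; first by apply: Hw; rewrite leqnn.
  by move=> k; rewrite -eqn_leq => /eqP <-.
by rewrite (markov_chain_recent (fun=> i) j mX).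
Qed.

Variable C : nat -> {RV P >-> nat}.
Hypothesis CP : C_process C.

Lemma C_transition_ge0 i j : 0 <= C_transition R i j.
Proof.
rewrite /C_transition; case: ifPn => // ij.
by rewrite divr_ge0// mulr_ge0// subr_ge0 ler1n (leq_trans _ ij).
Qed.

(** The chain starts at 1, where [eigenfun z] is 1. Each step contributes [z^-1]: expand the law of
    [C n.+1], exchange the nonnegative sums and apply [C_transition_eigenfun]. *)
Lemma integral_eigenfun z n : 0 < z ->
  (\int[P]_w (eigenfun z (C n w))%:E = (z ^- n)%:E)%E.
Proof.
case: CP => Cpos C0 Cmarkov z0.
have h0 i : 0 <= eigenfun z i by exact: eigenfun_ge0.
elim: n => [|n IH].
  rewrite (eq_integral (fun=> (eigenfun z 1)%:E)); last by move=> w _; rewrite C0.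
  rewrite integral_cst// [X in (_ * X)%E](_ : _ = 1%E) ?mule1; last exact: probability_setT.
  by rewrite /eigenfun /growth big_ord0 expr0 invr1 mulr1.
rewrite integral_fibers// (eq_eseriesr (g := fun j => \sum_(0 <= i <oo)
    (eigenfun z j * C_transition R i j)%:E * P (C n @^-1` [set i])))%E; last first.
  move=> j _; rewrite (markov_chain_step _ _ Cmarkov) -nneseriesZl.
    by apply: eq_eseriesr => i _; rewrite EFinM muleA.
  by move=> i _; rewrite mule_ge0// lee_fin C_transition_ge0.
rewrite nneseries_interchange; last first.
  by move=> i j; rewrite mule_ge0// lee_fin mulr_ge0// C_transition_ge0.
transitivity (\sum_(0 <= i <oo) z^-1%:E * ((eigenfun z i)%:E * P (C n @^-1` [set i])))%E.
  (* The eigenfunction equation is available for positive states only; state 0 has probability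
     zero. *)
  apply: eq_eseriesr => -[|i] _.
    have -> : P (C n @^-1` [set 0%N]) = 0%E.
      rewrite (_ : _ @^-1` _ = set0); first exact: measure0.
      by apply/seteqP; split => w //= Cw; have := Cpos n w; rewrite Cw.
    by rewrite !mule0 eseries0// => j _ _; rewrite mule0.
  rewrite (eq_eseriesr (g := fun j => P (C n @^-1` [set i.+1]) *
    (C_transition R i.+1 j * eigenfun z j)%:E))%E; last first.
    by move=> j _; rewrite muleC mulrC.
  rewrite -[P _]fineK ?fin_num_measure// nneseriesZl; last first.
    by move=> j _; rewrite lee_fin mulr_ge0// C_transition_ge0.
  rewrite C_transition_eigenfun// -!EFinM; congr (_%:E).
  by ring.
rewrite nneseriesZl; last by move=> i _; rewrite mule_ge0// lee_fin.
by rewrite -integral_fibers// IH -EFinM exprS invfM.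
Qed.

Lemma probability_C_eq1 n : P (C n.+1 @^-1` [set 1%N]) = 0%E.
Proof.
case: CP => Cpos _ Cmarkov.
rewrite (markov_chain_step _ _ Cmarkov) eseries0// => -[|i] _ _.
  (* From state 0 to 1 the kernel takes the value 0 / 0, which is 0. *)
  by rewrite /C_transition/= mul0r mul0e.
by rewrite /C_transition/= mul0e.
Qed.

End MarkovMarginals.

(** * Moments of C_n up to constants, and their consequences for probabilities *)

Section MomentBounds.
Context d (T : measurableType d) (R : realType) (P : probability T R).
Variable C : nat -> {RV P >-> nat}.
Hypothesis CP : C_process C.
Implicit Types (z c : R) (n : nat) (A : set T).

Local Notation logC n w := (ln (C n w)%:R).

Lemma measurable_fun_comp_C n (f : nat -> R) : measurable_fun setT (fun w => (f (C n w))%:E).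
Proof.
apply/measurable_EFinP => /=.
by apply: (measurableT_comp (g := C n)) => //; exact: measurable_funPT.
Qed.

Lemma moment_bounds z n : 0 < z ->
  ((expR (- log_slack z - n%:R * ln z))%:E <= \int[P]_w (expR ((1 - z) * logC n w))%:E
    <= (expR (log_slack z - n%:R * ln z))%:E)%E.
Proof.
case: (CP) => Cpos _ _ z0.
have key (e : R) : (\int[P]_w ((expR e)%:E * (eigenfun z (C n w))%:E) =
    (expR (e - n%:R * ln z))%:E)%E.
  rewrite ge0_integralZl//; first last.
  - by move=> w _; rewrite lee_fin eigenfun_ge0.
  - exact: (measurable_fun_comp_C n (eigenfun z)).
  by rewrite integral_eigenfun// -EFinM expRB expRM_natl lnK.
have mf : measurable_fun setT (fun w => (expR ((1 - z) * logC n w))%:E).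
  exact: (measurable_fun_comp_C n (fun i => expR ((1 - z) * ln i%:R))).
have mg e : measurable_fun setT (fun w => ((expR e)%:E * (eigenfun z (C n w))%:E)%E).
  exact: (measurable_fun_comp_C n (fun i => expR e * eigenfun z i)).
have f0 w : (0 <= (expR ((1 - z) * logC n w))%:E)%E by rewrite lee_fin expR_ge0.
have g0 e w : (0 <= (expR e)%:E * (eigenfun z (C n w))%:E)%E.
  by rewrite -EFinM lee_fin mulr_ge0 ?expR_ge0 ?eigenfun_ge0.
have bnd w := eigenfun_bounds z0 (Cpos n w).
rewrite -!key; apply/andP; split; apply: ge0_le_integral => // w _;
  rewrite -EFinM lee_fin; have /andP[lo up] := bnd w.
- rewrite -(ler_pM2l (expR_gt0 (- log_slack z))) in up; apply: le_trans up _.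
  by rewrite -expRD ler_expR /log_slack; lra.
- rewrite -(ler_pM2l (expR_gt0 (log_slack z))) in lo; apply: le_trans lo.
  by rewrite -expRD ler_expR /log_slack; lra.
Qed.

(** Chernoff's bound. Bounding the whole exponent [(1 - z) * logC n w] from below, and not [logC],
    covers upper tails (z < 1) and lower tails (z > 1) alike. *)
Lemma probability_le_moment z c n A : 0 < z -> measurable A ->
  (forall w, A w -> c <= (1 - z) * logC n w) ->
  (P A <= (expR (log_slack z - n%:R * ln z - c))%:E)%E.
Proof.
move=> z0 mA Ac; have /andP[_ up] := moment_bounds n z0.
rewrite expRD mulrC EFinM expRN lee_pdivlMl ?expR_gt0//.
have -> : (P A = \int[P]_w (\1_A w)%:E)%E by rewrite integral_indic// setIT.
apply: le_trans up; rewrite -ge0_integralZl//; first last.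
- by apply/measurable_EFinP; exact: measurable_indic.
apply: ge0_le_integral => //.
- apply/measurable_EFinP; apply: measurable_funM => //; exact: measurable_indic.
- exact: (measurable_fun_comp_C n (fun i => expR ((1 - z) * ln i%:R))).
- move=> w _; rewrite -EFinM lee_fin indicE; case: (boolP (w \in A)) => wA.
    by rewrite mulr1 ler_expR Ac//; exact: set_mem.
  by rewrite mulr0 expR_ge0.
Qed.

(** On [A] the integrand is at most [expR c]; off [A] it is dominated by one of the integrands for
    [z1] and [z2], whose integrals are known. This turns the lower moment bound into a lower bound
    on [P A]. *)
Lemma moment_le_split z z1 z2 c c1 c2 n A : 0 < z -> 0 < z1 -> 0 < z2 -> measurable A ->
  (forall w, A w -> (1 - z) * logC n w <= c) ->
  (forall w, ~ A w -> (1 - z) * logC n w <= (1 - z1) * logC n w + c1 \/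
                      (1 - z) * logC n w <= (1 - z2) * logC n w + c2) ->
  expR (- log_slack z - n%:R * ln z) <= expR c * fine (P A)
    + expR (c1 + log_slack z1 - n%:R * ln z1) + expR (c2 + log_slack z2 - n%:R * ln z2).
Proof.
move=> z0 z10 z20 mA Ac Anc; have /andP[lo _] := moment_bounds n z0.
have mf (y b : R) : measurable_fun setT (fun w => (expR b * expR ((1 - y) * logC n w))%:E).
  exact: (measurable_fun_comp_C n (fun i => expR b * expR ((1 - y) * ln i%:R))).
have f0 (y b : R) w : (0 <= (expR b * expR ((1 - y) * logC n w))%:E)%E.
  by rewrite lee_fin mulr_ge0 ?expR_ge0.
have up (y b : R) : 0 < y ->
    (\int[P]_w (expR b * expR ((1 - y) * logC n w))%:E
     <= (expR (b + log_slack y - n%:R * ln y))%:E)%E.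
  move=> y0; have /andP[_ h] := moment_bounds n y0.
  under eq_integral do rewrite EFinM.
  rewrite ge0_integralZl//; first last.
  - exact: (measurable_fun_comp_C n (fun i => expR ((1 - y) * ln i%:R))).
  apply: le_trans (lee_wpmul2l _ h) _; first by rewrite lee_fin expR_ge0.
  by rewrite -EFinM -expRD addrA.
have mA1 : measurable_fun setT (fun w => (expR c * \1_A w)%:E).
  apply/measurable_EFinP; apply: measurable_funM => //; exact: measurable_indic.
have A10 w : (0 <= (expR c * \1_A w)%:E)%E.
  by rewrite lee_fin mulr_ge0// expR_ge0.
have iA : (\int[P]_w (expR c * \1_A w)%:E = (expR c * fine (P A))%:E)%E.
  under eq_integral do rewrite EFinM.
  rewrite ge0_integralZl//; first last.
  - by apply/measurable_EFinP; exact: measurable_indic.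
  by rewrite integral_indic// setIT EFinM fineK ?fin_num_measure.
rewrite -lee_fin !EFinD -iA; apply: le_trans lo _.
apply: le_trans (leeD (leeD2l _ (up z1 c1 z10)) (up z2 c2 z20)).
rewrite -!ge0_integralD//; first last.
- exact: emeasurable_funD.
- by move=> w _; rewrite adde_ge0.
apply: ge0_le_integral => //.
- exact: (measurable_fun_comp_C n (fun i => expR ((1 - z) * ln i%:R))).
- by apply: emeasurable_funD => //; exact: emeasurable_funD.
move=> w _; rewrite -!EFinD lee_fin -!expRD indicE.
have e0 b : 0 <= expR b :> R by exact: expR_ge0.
have [wA|wA] := boolP (w \in A).
  rewrite mulr1 -addrA ler_wpDr ?addr_ge0// ler_expR; apply: Ac; exact: set_mem.
rewrite mulr0 add0r; have /Anc[H|H] : ~ A w by move=> /mem_set; exact/negP.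
  by rewrite ler_wpDr// ler_expR; lra.
by rewrite ler_wpDl// ler_expR; lra.
Qed.

End MomentBounds.

(** * Goodness of the rate function *)

Section RateFunction.
Context {R : realType}.
Implicit Types x a r : R.

Lemma I_CE x : -1 < x -> I_C x = (x - ln (x + 1))%:E.
Proof. by rewrite /I_C => ->. Qed.

Lemma I_C_pinfty x : x <= -1 -> I_C x = +oo%E.
Proof. by rewrite /I_C ltNge => ->. Qed.

Lemma I_C_ge0 x : (0 <= I_C x)%E.
Proof.
rewrite /I_C; case: ifPn => // x1.
by have := le_ln1Dx x1; rewrite lee_fin addrC; lra.
Qed.

Lemma I_C_lsc : lower_semicontinuous (@I_C R).
Proof.
move=> x a; have [x1|x1|->] := ltgtP x (-1).
- exists [set y | y < -1]; first exact: lt_nbhsl.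
  by move=> y /= y1; rewrite I_C_pinfty ?ltry// ltW.
- rewrite I_CE// lte_fin => ax.
  have cf : {for x, continuous (fun y : R => y - ln (y + 1))}.
    apply: continuousB; first exact: cvg_id.
    apply: (@continuous_comp _ _ _ (fun y : R => y + 1) (@ln R)).
      by apply: continuousD; [exact: cvg_id|exact: cvg_cst].
    by apply: continuous_ln; lra.
  exists [set y | -1 < y /\ a < y - ln (y + 1)].
    apply: filterI; first exact: lt_nbhsr.
    exact: (cvgr_gt _ cf _ ax).
  by move=> y [y1 ay]; rewrite I_CE.
(* At the boundary point -1, this radius makes -ln (y + 1) > a + 1, which together with y > -1 gives
   I_C(y) > a. *)
- move=> _; exists [set y | y < -1 + expR (- a - 1)].
    by apply: lt_nbhsl; rewrite ltrDl expR_gt0.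
  move=> y /= ya; have [y1|y1] := lerP y (-1); first by rewrite I_C_pinfty ?ltry.
  rewrite I_CE// lte_fin.
  have : ln (y + 1) < - a - 1 by rewrite -ltr_expR lnK ?posrE; lra.
  lra.
Qed.

Lemma I_C_good : good_rate_function (@I_C R).
Proof.
split; [exact: I_C_ge0|exact: I_C_lsc|move=> a _].
(* The tangent bound on ln at (y + 1) / 2 gives I_C(y) >= (y + 1) / 2 - ln 2, hence the right
   endpoint. *)
apply: (@subclosed_compact _ _ `[-1, 2 * a + 2 * ln 2]).
- have /lower_semicontinuousP/(_ a) := I_C_lsc; rewrite -closedC; congr closed.
  by apply/seteqP; split => y /=; rewrite leNgt => /negP.
- exact: segment_compact.
- move=> y /=; rewrite /I_C; case: ifPn => // y1; rewrite lee_fin in_itv/= => ya.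
  apply/andP; split; first exact: ltW.
  have y2 : 0 < (y + 1) / 2 by lra.
  have : ln ((y + 1) / 2) <= (y + 1) / 2 - 1.
    by have := @le_ln1Dx R ((y + 1) / 2 - 1); rewrite subrKC; apply; lra.
  rewrite ln_div ?posrE; lra.
Qed.

End RateFunction.

(** * From exponential bounds to scaled logarithms and upper limits *)

Section ScaledLog.
Context d (T : measurableType d) (R : realType) (P : probability T R).
Implicit Types (Y : nat -> {RV P >-> R}) (G : set R) (r : R) (c : \bar R).

Lemma scaled_log_prob_le Y G n r : (0 < n)%N ->
  (P (Y n @^-1` G) <= (expR (- (n%:R * r)))%:E)%E ->
  (scaled_log_prob Y G n <= (- r)%:E)%E.
Proof.
move=> n0 h; rewrite /scaled_log_prob.
have -> : - r = n%:R^-1 * (- (n%:R * r)).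
  by field; rewrite pnatr_eq0 -lt0n.
rewrite EFinM lee_pmul2l// ?lte_fin ?invr_gt0 ?ltr0n//.
rewrite -[- _]expRK -lne_EFin ?expR_gt0// lee_lne// in_itv/= leey andbT.
  exact: measure_ge0.
by rewrite lee_fin expR_ge0.
Qed.

Lemma scaled_log_prob_ge Y G n r : (0 < n)%N ->
  ((expR (- (n%:R * r)))%:E <= P (Y n @^-1` G))%E ->
  ((- r)%:E <= scaled_log_prob Y G n)%E.
Proof.
move=> n0 h; rewrite /scaled_log_prob.
have -> : - r = n%:R^-1 * (- (n%:R * r)).
  by field; rewrite pnatr_eq0 -lt0n.
rewrite EFinM lee_pmul2l// ?lte_fin ?invr_gt0 ?ltr0n//.
rewrite -[- _]expRK -lne_EFin ?expR_gt0// lee_lne// in_itv/= leey andbT.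
  by rewrite lee_fin expR_ge0.
exact: measure_ge0.
Qed.

(** Testing real levels above [c] lets exponential bounds with real rates be used even when [c] is
    infinite. *)
Lemma limn_esup_le_near (u : (\bar R)^nat) c :
  (forall r, (c < r%:E)%E -> \forall n \near \oo, (u n <= r%:E)%E) ->
  (limn_esup u <= c)%E.
Proof.
move=> h; have k r : (c < r%:E)%E -> (limn_esup u <= r%:E)%E.
  move=> /h nu; apply: ge_ereal_inf; exists (ereal_sup (u @` [set n | (u n <= r%:E)%E])).
    by exists [set n | (u n <= r%:E)%E].
  by apply: ge_ereal_sup => _ [n ? <-].
case: c {h} k => [c| |] k.
- by apply/lee_addgt0Pr => e e0; rewrite -EFinD; apply: k; rewrite lte_fin ltrDl.
- exact: leey.
- by rewrite leeNy_eq; apply/eqP/eq_ninfty => r; apply: k; exact: ltNyr.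
Qed.

Lemma near_mulrn_ge (c K : R) : 0 < c -> \forall n \near \oo, K <= n%:R * c.
Proof.
move=> c0; have /cvgryPge/(_ (K / c)) := @cvgr_idn R.
by apply: filterS => n; rewrite ler_pdivrMr.
Qed.

End ScaledLog.

Lemma measurable_closed_window {R : realType} (x e : R) :
  measurable [set y : R | `|x - y| <= e].
Proof.
rewrite (_ : [set y : R | _] = `[x - e, x + e]%classic); first exact: measurable_itv.
by apply/seteqP; split => y /=; rewrite in_itv/= ler_distlC.
Qed.

Lemma closure_inf {R : realType} (A : set R) :
  A !=set0 -> has_lbound A -> closure A (inf A).
Proof.
move=> A0 Alb B /nbhs_ballP[e e0 eB].
have [y Ay ye] := inf_adherent e0 (conj A0 Alb).
exists y; split => //; apply: eB; rewrite -ball_normE /ball_/= ltr_norml.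
have := ge_inf Alb Ay; move: e0 ye => /=; lra.
Qed.

(** * Upper and lower large deviation bounds *)

Section LargeDeviations.
Context d (T : measurableType d) (R : realType) (P : probability T R).
Variable C : nat -> {RV P >-> nat}.
Hypothesis CP : C_process C.
Implicit Types (x y r : R) (n : nat) (G : set R).

Local Notation Y := (fun n => log_C_normalized C n : {RV P >-> R}).

Lemma measurable_preimage_log_C n G : measurable G -> measurable (Y n @^-1` G).
Proof. by move=> mG; exact: measurable_funPTI. Qed.

Lemma log_C_normalizedE n w : (0 < n)%N -> ln (C n w)%:R = n%:R * (1 + Y n w).
Proof.
by move=> n0; rewrite /= /log_C_normalized; field; rewrite pnatr_eq0 -lt0n.
Qed.

Lemma ln_inv1D x : -1 < x -> ln (1 + x)^-1 = - ln (x + 1).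
Proof. by move=> x1; rewrite lnV ?posrE addrC//; lra. Qed.

(* [x * x <= x * y] says that y lies beyond x on the side away from 0, which
   treats both tails at once. *)
Lemma probability_halfline_le x r G : measurable G -> -1 < x -> (r%:E < I_C x)%E ->
  (forall y, G y -> x * x <= x * y) ->
  \forall n \near \oo, (P (Y n @^-1` G) <= (expR (- (n%:R * r)) / 2)%:E)%E.
Proof.
move=> mG x1; rewrite I_CE// lte_fin => rx Gx.
(* This z minimizes the Chernoff exponent -ln z - (1 - z)(1 + x); the minimum is -I_C(x). *)
have z0 : 0 < (1 + x)^-1 by rewrite invr_gt0; lra.
(* The [ln 2] pays for the factor 1/2 in the claim, there because two tails will be added. *)
pose K := log_slack (1 + x)^-1 + ln 2.
have c0 : 0 < x - ln (x + 1) - r by lra.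
near=> n.
have n0 : (0 < n)%N by near: n; exact: nbhs_infty_gt.
have Kn : K <= n%:R * (x - ln (x + 1) - r) by near: n; exact: near_mulrn_ge.
apply: (le_trans (probability_le_moment CP (n := n) (z := (1 + x)^-1) (c := n%:R * x)
   z0 (measurable_preimage_log_C n mG) _)).
  move=> w /= /Gx xY; rewrite (log_C_normalizedE w n0) mulrCA ler_pM2l ?ltr0n//.
  have -> : (1 - (1 + x)^-1) * (1 + Y n w) = (x + x * Y n w) / (1 + x).
    by field; rewrite gt_eqF//; lra.
  by rewrite ler_pdivlMr /=; lra.
rewrite lee_fin -[X in _ / X]lnK ?posrE// -expRN -expRD ler_expR ln_inv1D//.
by move: Kn; rewrite /K; lra.
Unshelve. all: by end_near.
Qed.

(** A normalized value of at most -1 means log C_n <= 0, so C_n = 1, which is a null event once a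
    step has been made. *)
Lemma probability_log_C_leN1 n G : (0 < n)%N -> measurable G -> (forall y, G y -> y <= -1) ->
  P (Y n @^-1` G) = 0%E.
Proof.
move=> n0 mG G1; apply/eqP; rewrite -measure_le0.
rewrite -(probability_C_eq1 CP n.-1) prednK//.
apply: le_measure; rewrite ?inE; [exact: measurable_preimage_log_C|exact: measurable_fiber|].
move=> w /= /G1 Y1; have [Cpos _ _] := CP.
have Cle : (C n w)%:R <= 1 :> R.
  rewrite -ler_ln ?posrE ?ltr0n// ln1 (log_C_normalizedE w n0).
  by rewrite pmulr_rle0 ?ltr0n// /=; lra.
by apply/eqP; rewrite eqn_leq Cpos andbT -(ler_nat R).
Qed.

(** If 0 lies in the closure, the infimum is 0 and the bound is trivial. Otherwise [G] splits at 0,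
    and each part lies beyond its point nearest to 0, which belongs to [closure G]; the half-line
    bound applies there, or the part is null if that point is at most -1. *)
Lemma ldp_upper G : measurable G ->
  (limn_esup (scaled_log_prob Y G) <= - ereal_inf (@I_C R @` closure G))%E.
Proof.
move=> mG; apply: limn_esup_le_near => r' hr.
rewrite -[r']opprK in hr *; move: (- r') hr => r; rewrite EFinN lteN2 => rc.
have rI y : closure G y -> (r%:E < I_C y)%E.
  by move=> Gy; apply: lt_le_trans rc _; apply: ge_ereal_inf; exists (I_C y) => //; exists y.
suff : \forall n \near \oo, (P (Y n @^-1` G) <= (expR (- (n%:R * r)))%:E)%E.
  move=> h; near=> n; apply: scaled_log_prob_le.
    by near: n; exact: nbhs_infty_gt.
  by near: n.
have [G0|G0] := pselect (closure G 0).
  have : (r%:E < 0)%E.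
    by have := rI 0 G0; rewrite I_CE ?ltrN10// !add0r ln1 oppr0.
  rewrite lte_fin => r0; apply: nearW => n.
  apply: le_trans (probability_le1 _ (measurable_preimage_log_C n mG)) _.
  by rewrite lee_fin -expR0 ler_expR oppr_ge0 mulr_ge0_le0// ltW.
pose Gp := G `&` [set y | 0 < y]; pose Gn := G `&` [set y | y < 0].
have mGp : measurable Gp.
  apply: measurableI => //; rewrite (_ : [set y | _] = `]0, +oo[%classic)//.
  by apply/seteqP; split => y /=; rewrite in_itv/= andbT.
have mGn : measurable Gn.
  by apply: measurableI => //; rewrite (_ : [set y | _] = `]-oo, 0[%classic)//.
have GU : G = Gp `|` Gn.
  apply/seteqP; split => [y Gy|y []]; [|by case..].
  have [y0|y0|y0] := ltgtP y 0; [by right|by left|].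
  by exfalso; apply: G0; rewrite -y0; exact: subset_closure.
suff hp : \forall n \near \oo, (P (Y n @^-1` Gp) <= (expR (- (n%:R * r)) / 2)%:E)%E.
  suff hn : \forall n \near \oo, (P (Y n @^-1` Gn) <= (expR (- (n%:R * r)) / 2)%:E)%E.
    near=> n; rewrite GU preimage_setU.
    apply: le_trans (measureU2 _ _ _) _; [exact: measurable_preimage_log_C..|].
    have -> : expR (- (n%:R * r)) = expR (- (n%:R * r)) / 2 + expR (- (n%:R * r)) / 2.
      by field.
    by rewrite EFinD; apply: leeD; near: n.
  have vanish : (forall y, Gn y -> y <= -1) ->
      \forall n \near \oo, (P (Y n @^-1` Gn) <= (expR (- (n%:R * r)) / 2)%:E)%E.
    move=> h; near=> n; rewrite probability_log_C_leN1//.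
    by near: n; exact: nbhs_infty_gt.
  have [[y0 Gny0]|Gn0] := pselect (exists y, Gn y); last first.
    by apply: vanish => y Gny; exfalso; apply: Gn0; exists y.
  have ubn : has_ubound Gn by exists 0 => y [_ /ltW].
  have Gs y : Gn y -> y <= sup Gn by move=> Gny; exact: ub_le_sup.
  have clG : closure G (sup Gn).
    apply: (closureS (A := Gn)); first by move=> y [].
    by apply: closure_sup => //; exists y0.
  have [s1|s1] := lerP (sup Gn) (-1).
    by apply: vanish => y /Gs /le_trans; apply.
  have s0 : sup Gn < 0.
    rewrite lt_neqAle; apply/andP; split.
      by apply/eqP => s0; apply: G0; rewrite -s0.
    by apply: ge_sup; [exists y0|move=> y [_ /ltW]].
  apply: (probability_halfline_le mGn s1 (rI _ clG)) => y /Gs ys.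
  by rewrite ler_nM2l.
have [[y0 Gpy0]|Gp0] := pselect (exists y, Gp y); last first.
  apply: nearW => n; rewrite (_ : Gp = set0) ?preimage_set0 ?measure0.
    by rewrite lee_fin divr_ge0 ?expR_ge0.
  by apply/seteqP; split => y // Gpy; exfalso; apply: Gp0; exists y.
have lbp : has_lbound Gp by exists 0 => y [_ /ltW].
have Gs y : Gp y -> inf Gp <= y by move=> Gpy; exact: ge_inf.
have clG : closure G (inf Gp).
  apply: (closureS (A := Gp)); first by move=> y [].
  by apply: closure_inf => //; exists y0.
have s0 : 0 < inf Gp.
  rewrite lt_neqAle; apply/andP; split.
    by apply/eqP => s0; apply: G0; rewrite s0.
  by apply: lb_le_inf; [exists y0|move=> y [_ /ltW]].
have s1 : -1 < inf Gp by lra.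
apply: (probability_halfline_le mGp s1 (rI _ clG)) => y /Gs ys.
by rewrite ler_pM2l.
Unshelve. all: by end_near.
Qed.

(* Perturbing z = 1 / (1 + x) to z (1 - u) and z (1 + u) in [moment_le_split]
   makes the contribution of each side of the window exponentially negligible. *)
Lemma probability_window_ge x (e : R) : -1 < x -> 0 < e ->
  exists c K : R, 0 < c /\ \forall n \near \oo,
  expR (- log_slack (1 + x)^-1 - n%:R * ln (1 + x)^-1)
  <= expR (n%:R * (x + `|1 - (1 + x)^-1| * e)) *
       fine (P (Y n @^-1` [set y : R | `|x - y| <= e]))
     + expR (K - n%:R * c - n%:R * ln (1 + x)^-1).
Proof.
move=> x1 e0; set z := (1 + x)^-1.
have s0 : 0 < 1 + x by lra.
have z0 : 0 < z by rewrite invr_gt0.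
have zs : z * (1 + x) = 1 by rewrite mulVf// gt_eqF.
have ze0 : 0 < z * e by rewrite mulr_gt0.
(* The gain u z e is of first order in u, the loss at most 2 u^2. The bound 1/2 controls u / (1 -
   u); the bound z e / 4 leaves the net gain [c], half of u z e. *)
pose u := Num.min 2^-1 (z * e / 4).
have u0 : 0 < u by rewrite lt_min; apply/andP; split; lra.
have u2 : u <= 2^-1 by rewrite ge_min lexx.
have ue : u <= z * e / 4 by rewrite ge_min lexx orbT.
have lnm : ln (z * (1 - u)) = ln z + ln (1 - u) by rewrite lnM ?posrE//; lra.
have lnp : ln (z * (1 + u)) = ln z + ln (1 + u) by rewrite lnM ?posrE//; lra.
pose c := u * (z * e) / 2.
have c0 : 0 < c by rewrite divr_gt0// mulr_gt0.
have cm : c <= u + u * (z * e) + ln (1 - u).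
  have : - u / (1 - u) <= ln (1 - u) by apply: ln1D_ge; lra.
  have : - u - 2 * (u * u) <= - u / (1 - u).
    by rewrite ler_pdivlMr; nra.
  rewrite /c; nra.
have cp : c <= - u + u * (z * e) + ln (1 + u).
  have : u / (1 + u) <= ln (1 + u) by apply: ln1D_ge; lra.
  have : u - u * u <= u / (1 + u).
    by rewrite ler_pdivlMr; nra.
  rewrite /c; nra.
pose K1 := log_slack (z * (1 - u)); pose K2 := log_slack (z * (1 + u)).
exists c, (ln (expR K1 + expR K2)); split => //; near=> n.
have n0 : (0 < n)%N by near: n; exact: nbhs_infty_gt.
have n0R : 0 < n%:R :> R by rewrite ltr0n.
(* The perturbations change the exponent by u z log C_n, up to sign; the constants are its values at
   the two edges of the window. *)
have := @moment_le_split _ _ _ _ _ CP z (z * (1 - u)) (z * (1 + u))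
  (n%:R * (x + `|1 - z| * e)) (- (n%:R * (u * z * (1 + x + e))))
  (n%:R * (u * z * (1 + x - e))) n
  (Y n @^-1` [set y : R | `|x - y| <= e]) z0.
have mYW := measurable_preimage_log_C n (measurable_closed_window x e).
move=> H; apply: le_trans (H _ _ mYW _ _) _.
- by rewrite mulr_gt0//; lra.
- by rewrite mulr_gt0//; lra.
- move=> w /= xY; rewrite (log_C_normalizedE w n0) mulrCA ler_pM2l//=.
  have -> : (1 - z) * (1 + log_C_normalized C n w)
     = (1 - z) * (1 + x) + (1 - z) * (log_C_normalized C n w - x) by ring.
  have -> : (1 - z) * (1 + x) = x by rewrite mulrBl zs; ring.
  rewrite lerD2l; apply: le_trans (ler_norm _) _.
  by rewrite normrM ler_wpM2l// distrC.
- move=> w /= /negP; rewrite -ltNge (log_C_normalizedE w n0)/=.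
  move: (log_C_normalized C n w) => y; rewrite ltr_normr => /orP[h|h].
    right; rewrite -subr_ge0.
    have -> : (1 - z * (1 + u)) * (n%:R * (1 + y)) + n%:R * (u * z * (1 + x - e)) -
      (1 - z) * (n%:R * (1 + y)) = n%:R * (u * z * (x - y - e)) by ring.
    by rewrite !mulr_ge0// ?ltW//; lra.
  left; rewrite -subr_ge0.
  have -> : (1 - z * (1 - u)) * (n%:R * (1 + y)) - n%:R * (u * z * (1 + x + e)) -
    (1 - z) * (n%:R * (1 + y)) = n%:R * (u * z * (y - x - e)) by ring.
  by rewrite !mulr_ge0// ?ltW//; lra.
rewrite -addrA lerD2l.
have -> : expR (ln (expR K1 + expR K2) - n%:R * c - n%:R * ln z) =
    (expR K1 + expR K2) * expR (- (n%:R * c) - n%:R * ln z).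
  by rewrite -addrA expRD lnK// posrE addr_gt0 ?expR_gt0.
have uz1 : u * z * (1 + x + e) = u + u * (z * e) by rewrite -mulrA mulrDr zs; ring.
have uz2 : u * z * (1 + x - e) = u - u * (z * e).
  by rewrite -mulrA mulrBr zs; ring.
rewrite mulrDl -!expRD; apply: lerD; rewrite ler_expR.
- rewrite lnm uz1 -/K1.
  have : n%:R * c <= n%:R * (u + u * (z * e) + ln (1 - u)) by rewrite ler_pM2l.
  lra.
- rewrite lnp uz2 -/K2.
  have : n%:R * c <= n%:R * (- u + u * (z * e) + ln (1 + u)) by rewrite ler_pM2l.
  lra.
Unshelve. all: by end_near.
Qed.

Lemma probability_ge_near x r G : measurable G -> G° x -> -1 < x -> x - ln (x + 1) < r ->
  \forall n \near \oo, ((expR (- (n%:R * r)))%:E <= P (Y n @^-1` G))%E.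
Proof.
move=> mG /nbhs_ballP[e /= e0 eG] x1 xr.
set z := (1 + x)^-1; set q := `|1 - z|.
have q0 : 0 <= q by exact: normr_ge0.
set g := r - (x - ln (x + 1)).
have g0 : 0 < g by rewrite /g; lra.
(* The first bound keeps the closed window inside the ball in [G], the second keeps the loss
   [q * e1] below [g / 2]; [q + 1] avoids dividing by 0 when x = 0. *)
pose e1 := Num.min (e / 2) (g / (2 * (q + 1))).
have e10 : 0 < e1.
  by rewrite lt_min !divr_gt0// mulr_gt0//; lra.
have e1e : e1 < e by rewrite gt_min; apply/orP; left; lra.
have qe1 : q * e1 <= g / 2.
  have : e1 <= g / (2 * (q + 1)) by rewrite ge_min lexx orbT.
  rewrite ler_pdivlMr; nra.
pose W := [set y : R | `|x - y| <= e1].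
have [c [K [c0 near_window]]] := probability_window_ge x1 e10.
near=> n.
have Hn : expR (- log_slack z - n%:R * ln z)
  <= expR (n%:R * (x + q * e1)) * fine (P (Y n @^-1` W))
     + expR (K - n%:R * c - n%:R * ln z) by near: n.
have nc : K + log_slack z + ln 2 <= n%:R * c by near: n; exact: near_mulrn_ge.
have ng : log_slack z + ln 2 <= n%:R * (g / 2).
  by near: n; apply: near_mulrn_ge; lra.
have mYW := measurable_preimage_log_C n (measurable_closed_window x e1).
have AG : (P (Y n @^-1` W) <= P (Y n @^-1` G))%E.
  apply: le_measure; rewrite ?inE//; first exact: measurable_preimage_log_C.
  move=> w /= h; apply: eG; rewrite -ball_normE /ball_/=; exact: le_lt_trans h e1e.
apply: le_trans AG; rewrite -[leRHS]fineK ?fin_num_measure// lee_fin.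
(* The part outside the window is at most half of the lower moment bound, so the window carries the
   other half. *)
have half : expR (K - n%:R * c - n%:R * ln z) <= expR (- log_slack z - n%:R * ln z) / 2.
  rewrite -[X in _ / X]lnK ?posrE// -expRN -expRD ler_expR; lra.
have h : expR (- log_slack z - n%:R * ln z) / 2
    <= expR (n%:R * (x + q * e1)) * fine (P (Y n @^-1` W)).
  lra.
rewrite -(ler_pM2l (expR_gt0 (n%:R * (x + q * e1)))); apply: le_trans h.
rewrite -[X in _ / X]lnK ?posrE// -expRN -!expRD ler_expR ln_inv1D//.
have : n%:R * (q * e1) <= n%:R * (g / 2) by rewrite ler_wpM2l.
by move: ng; rewrite /g; lra.
Unshelve. all: by end_near.
Qed.

Lemma ldp_lower G : measurable G ->
  (- ereal_inf (@I_C R @` G°) <= limn_einf (scaled_log_prob Y G))%E.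
Proof.
(* The lower limit is minus the upper limit of the negated sequence, so it suffices to treat each
   interior point x separately. *)
move=> mG; rewrite /limn_einf leeN2; apply/ereal_infP => _ [x Gx <-].
have [x1|x1] := ltP (-1) x; last by rewrite I_C_pinfty ?leey.
rewrite I_CE//; apply: limn_esup_le_near => r; rewrite lte_fin => xr.
near=> n; rewrite leeNl -EFinN; apply: scaled_log_prob_ge.
  by near: n; exact: nbhs_infty_gt.
by near: n; exact: (probability_ge_near mG Gx x1 xr).
Unshelve. all: by end_near.
Qed.

End LargeDeviations.

Theorem theorem1p3 (d : measure_display) (T : measurableType d) (R : realType)
    (P : probability T R) (C : nat -> {RV P >-> nat}) :
  C_process C ->
  large_deviation_principle (fun n => log_C_normalized C n : {RV P >-> R})
    (@I_C R).
Proof.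
move=> CP; split; first exact: I_C_good.
by move=> G mG; split; [exact: ldp_lower|exact: limn_einf_sup|exact: ldp_upper].
Qed.
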